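(* For each integer $n\ge 2$ the following inequalities hold: $$2\log n-\log(4\pi\log n)<b_n^2<2\log n.$$
   Context: $\Phi$ is the distribution function of the standard normal law and $b_n=\Phi^{-1}(1-\frac1n)$. Here $\log$ is the natural logarithm. *)

(* Defs.v *)
From HB Require Import structures.
From mathcomp Require Import all_boot all_order all_algebra.
From mathcomp Require Import all_classical all_reals all_analysis.

Set Implicit Arguments.
Unset Strict Implicit.
Unset Printing Implicit Defensive.

Local Open Scope classical_set_scope.
Local Open Scope ring_scope.

(* The identity is named so that it can carry a measurable-function instance
   and be used as a random variable with law [normal_prob]. *)
Definition idR {R : realType} : measurableTypeR R -> R := idfun.

HB.instance Definition _ (R : realType) :=
  @isMeasurableFun.Build _ _ _ _ (@idR R) (@measurable_id _ _ setT).

Definition Phi {R : realType} (x : R) : R :=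
  fine (cdf (idR : {RV (@normal_prob R 0 1) >-> R}) x).

Lemma PhiE (R : realType) (x : R) :
  Phi x = fine (\int[lebesgue_measure]_(t in `]-oo, x]) (normal_pdf 0 1 t)%:E).
Proof. by []. Qed.

(* Outside the range ]0, 1[ of [Phi] this takes the default value 0. *)
Definition Phi_inv {R : realType} : R -> R := 'pinv_(fun=> 0) [set: R] Phi.

Definition b_ {R : realType} (n : nat) : R := Phi_inv (1 - n%:R^-1).

(* Main.v *)
Require Import Defs.
From mathcomp Require Import all_boot all_order all_algebra.
From mathcomp Require Import all_classical all_reals all_analysis.
From mathcomp Require Import ring lra.
Import Order.TTheory GRing.Theory Num.Theory numFieldNormedType.Exports.

Local Open Scope ring_scope.

(** Write [L = ln n], [b = b_ n] and [phi] for the standard normal density.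
    Everything follows from [1 - Phi b = 1 / n] ([Phi_b]) and two bounds on the
    tail [1 - Phi], one on each side:
    - [1 - Phi x <= phi x] for [1 <= x] ([Phi_tail_le]);
    - [phi x / sqrt (x ^+ 2 + 2) <= 1 - Phi x] for every [x] ([Phi_tail_ge]).
    In each case the difference of the two sides has a nonpositive derivative
    and tends to [0] at infinity, hence is nonnegative.

    Upper bound. If [b ^+ 2 <= 1] the claim is [1 < 2 * L]. Otherwise
    [1 / n <= 1 - Phi `|b|], because by symmetry this tail is either [1 / n] or
    [1 - 1 / n]. The first tail bound then gives
    [1 / n <= phi b < exp (- b ^+ 2 / 2)], and one takes logarithms.

    Lower bound. Put [c = ln (4 * pi * L)] and suppose [b ^+ 2 <= 2 * L - c].
    Then [phi b ^+ 2 = exp (- b ^+ 2) / (2 * pi) >= 2 * L / n ^+ 2], whereas the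
    second tail bound, squared, gives [phi b ^+ 2 <= (b ^+ 2 + 2) / n ^+ 2].
    So [2 * L <= b ^+ 2 + 2], which contradicts [b ^+ 2 + c <= 2 * L] as soon as
    [2 < c]. This inequality holds for [n >= 3], and for [n = 2] the left-hand
    side of the claim is negative. *)

(** * A sign criterion at infinity *)

(** From [a] on, [f] is nonincreasing, so each value [f x] bounds from above the
    later ones, which are at least [h y]; letting [y] go to infinity gives [0].
    A lower bound [h] that vanishes at infinity is asked for, rather than the
    limit of [f], because it spares the computation of that limit. *)
Lemma ge0_of_derive_le0_cvg0 (R : realType) (f df h : R -> R) (a : R) :
  (forall x : R, is_derive x 1 f (df x)) ->
  (forall x, a <= x -> df x <= 0) ->
  (forall x, 0 < x -> h x <= f x) ->
  (h x @[x --> +oo] --> 0)%classic ->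
  forall x, a <= x -> 0 <= f x.
Proof.
move=> fdf df_le0 hf h0 x ax.
have f_le y : x <= y -> f y <= f x.
  move=> xy.
  have [|c] := @MVT_segment R f df x y xy (fun z _ => fdf z).
    apply: continuous_subspaceT => u.
    by apply/differentiable_continuous/derivable1_diffP; case: (fdf u).
  rewrite in_itv/= => /andP[xc _] fE.
  rewrite -subr_le0 fE mulr_le0_ge0 ?subr_ge0//.
  exact/df_le0/(le_trans ax).
apply: (ler_cvg_to h0 (cvg_cst (f x))).
near=> y.
apply: (le_trans (hf y _)); last apply: f_le.
  by near: y; apply: nbhs_pinfty_gt; rewrite num_real.
by near: y; apply: nbhs_pinfty_ge; rewrite num_real.
Unshelve. all: by end_near. Qed.

(** * The normal density *)

Definition phi {R : realType} (x : R) : R := normal_pdf 0 1 x.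

Lemma phiE (R : realType) (x : R) :
  phi x = (Num.sqrt (2 * pi))^-1 * expR (- (x ^+ 2 / 2)).
Proof.
rewrite /phi normal_pdfE ?oner_neq0// /normal_peak /normal_fun subr0 expr1n.
by rewrite mul1r mulNr mulr_natl.
Qed.

Lemma phiN (R : realType) (x : R) : phi (- x) = phi x.
Proof. by rewrite !phiE sqrrN. Qed.

Lemma sqrt_2pi_ge2 (R : realType) : 2 <= Num.sqrt (2 * pi) :> R.
Proof.
have p2 := @pi_ge2 R.
by rewrite -(@ler_pXn2r _ 2) ?nnegrE ?sqrtr_ge0// sqr_sqrtr; lra.
Qed.

Lemma phi_gt0 (R : realType) (x : R) : 0 < phi x.
Proof.
have := sqrt_2pi_ge2 R.
by rewrite phiE => s; rewrite mulr_gt0 ?expR_gt0// invr_gt0; lra.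
Qed.

Lemma phi_lt_expR (R : realType) (x : R) : phi x < expR (- (x ^+ 2 / 2)).
Proof.
have s2 := sqrt_2pi_ge2 R.
rewrite phiE gtr_pMl ?expR_gt0// invf_lt1; lra.
Qed.

Lemma is_derive_phi (R : realType) (x : R) : is_derive x 1 phi (- (x * phi x)).
Proof.
have -> : @phi R = (Num.sqrt (2 * pi))^-1 \*:
    (expR \o (- (2^-1 \*: (@idfun R) ^+ 2))).
  by apply/funext => y; rewrite phiE [_ / 2]mulrC.
apply: is_derive_eq.
rewrite /GRing.scale/= !fctE/= /GRing.scale/=; field.
have := sqrt_2pi_ge2 R; lra.
Qed.

(** * The normal distribution function *)

Lemma is_derive_Phi (R : realType) (x : R) : is_derive x 1 Phi (phi x).
Proof.
have [] := @continuous_FTC1 R phi -oo%O x (x + 1).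
- by rewrite ltrDl.
- apply: (integrableS _ _ (@subsetT _ _)) => //; exact: integrable_normal_pdf.
- by rewrite ltNyr.
- exact/continuous_normal_pdf/oner_neq0.
by move=> dF FE; apply: DeriveDef; [exact: dF | rewrite -derive1E FE].
Qed.

Lemma continuous_Phi (R : realType) : (continuous (@Phi R))%classic.
Proof.
move=> x; apply/differentiable_continuous/derivable1_diffP.
by case: (is_derive_Phi R x).
Qed.

Lemma Phi_cvg_y (R : realType) :
  (Phi x @[x --> (+oo : set_system R)] --> (1 : R))%classic.
Proof. exact: (fine_cvg (cvg_cdfy1 _)). Qed.

Lemma Phi_cvg_Ny (R : realType) :
  (Phi x @[x --> (-oo : set_system R)] --> (0 : R))%classic.
Proof. exact: (fine_cvg (cvg_cdfNy0 _)). Qed.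

(** [Phi x + Phi (- x)] is constant because [phi] is even, and it tends to
    [1 + 0] at infinity. *)
Lemma PhiN (R : realType) (x : R) : Phi (- x) = 1 - Phi x.
Proof.
pose g : R -> R := @Phi R + (@Phi R \o -%R).
have gE y : g y = g x.
  apply: is_derive_0_is_cst => z.
  have H1 := is_derive_Phi R z; have H2 := is_derive_Phi R (- z).
  by apply: is_derive_eq; rewrite phiN mulrN1 addrN.
suff g1 : g x = 1 by rewrite -g1 /g !fctE/= addrAC subrr add0r.
have gx : (g y @[y --> (+oo : set_system R)] --> g x)%classic.
  by under eq_fun do rewrite gE; exact: cvg_cst.
have : (g y @[y --> (+oo : set_system R)] --> (1 + 0 : R))%classic.
  apply: cvgD; first exact: Phi_cvg_y.
  have := Phi_cvg_Ny R; by rewrite cvgNy_compNP.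
by rewrite addr0; apply: cvg_unique gx.
Qed.

(** [Phi_inv] yields a preimage of any value that [Phi] attains, and [Phi]
    attains [1 - n%:R^-1] by the intermediate value theorem, this number lying
    strictly between the limits of [Phi]. *)
Lemma Phi_b (R : realType) (n : nat) : (2 <= n)%N ->
  Phi (b_ n : R) = 1 - n%:R^-1.
Proof.
move=> n2; rewrite /b_ /Phi_inv pinvK// inE/=.
have n_gt0 : 0 < n%:R :> R by rewrite ltr0n; case: n n2.
have n_ge2 : 2 <= n%:R :> R by rewrite ler_nat.
have nV1 : n%:R^-1 < 1 :> R by rewrite invf_lt1; lra.
have nV0 : 0 < n%:R^-1 :> R by rewrite invr_gt0.
near (-oo : set_system R)%classic => u.
near (+oo : set_system R)%classic => v.
have uv : u <= v.
  apply: (@le_trans _ _ 0).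
    by near: u; apply: nbhs_ninfty_le; rewrite num_real.
  by near: v; apply: nbhs_pinfty_ge; rewrite num_real.
have Pu : Phi u <= 1 - n%:R^-1.
  near: u; apply: (cvgr_le 0 (Phi_cvg_Ny R)); lra.
have Pv : 1 - n%:R^-1 <= Phi v.
  near: v; apply: (cvgr_ge 1 (Phi_cvg_y R)); lra.
have [||c _ cE] := @IVT R Phi u v (1 - n%:R^-1) uv.
- exact/continuous_subspaceT/continuous_Phi.
- by rewrite (min_idPl _) ?(max_idPr _) ?Pu//; exact: (le_trans Pu).
- by exists c.
Unshelve. all: by end_near. Qed.

(** * Bounds on the normal tail *)

Lemma is_derive_tail (R : realType) (x : R) :
  is_derive x 1 (fun y => 1 - Phi y) (- phi x).
Proof.
have H := is_derive_Phi R x.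
have -> : (fun y : R => 1 - Phi y) = cst 1 - Phi by [].
by apply: is_derive_eq; rewrite sub0r.
Qed.

(** The derivative of [phi - (1 - Phi)] is [(1 - y) * phi y], and the
    difference is at least [- (1 - Phi)]. *)
Lemma Phi_tail_le (R : realType) (x : R) : 1 <= x -> 1 - Phi x <= phi x.
Proof.
move=> x1; rewrite -subr_ge0.
pose f : R -> R := phi - (fun y => 1 - Phi y).
apply: (@ge0_of_derive_le0_cvg0 R f (fun y => - (y * phi y) - - phi y)
  (fun y => - (1 - Phi y)) 1 _ _ _ _ x) => //.
- move=> y; apply: is_deriveB; [exact: is_derive_phi|exact: is_derive_tail].
- by move=> y y1; have := phi_gt0 R y; nra.
- by move=> y _; rewrite /f !fctE; have := phi_gt0 R y; lra.
- rewrite -oppr0; apply: cvgN; rewrite -[X in (_ --> X)%classic](subrr 1).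
  by apply: cvgB; [exact: cvg_cst | exact: Phi_cvg_y].
Qed.

(** Crude, but enough to see that [phi] vanishes at infinity. *)
Lemma phi_le_inv (R : realType) (x : R) : 0 < x -> phi x <= x^-1.
Proof.
move=> x0; apply/ltW/(lt_le_trans (phi_lt_expR _ _)).
rewrite expRN lef_pV2 ?posrE ?expR_gt0//.
apply: le_trans (expR_ge1Dx _); nra.
Qed.

(** With [s = sqrt (y ^+ 2 + 2)], the derivative of [1 - Phi - phi / s] has the
    sign of [y * (s ^+ 2 + 1) - s ^+ 3]. For [y > 0] this is nonpositive because,
    with [t = s ^+ 2], [(t - 2) * (t + 1) ^+ 2 = t ^+ 3 - 3 * t - 2 <= t ^+ 3].
    The constant 2 is the least one for which this works for large [y]. *)
Lemma Phi_tail_ge (R : realType) (x : R) :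
  phi x / Num.sqrt (x ^+ 2 + 2) <= 1 - Phi x.
Proof.
pose s (y : R) := Num.sqrt (y ^+ 2 + 2).
have y2_gt0 (y : R) : 0 < y ^+ 2 + 2 by nra.
have s_gt0 y : 0 < s y by rewrite sqrtr_gt0.
have s2 y : s y ^+ 2 = y ^+ 2 + 2 by rewrite sqr_sqrtr// ltW.
have ds (y : R) : is_derive y 1 s (y / s y).
  have -> : s = Num.sqrt \o ((@idfun R) ^+ 2 + cst 2) by [].
  have H := is_derive1_sqrt (y2_gt0 y).
  apply: is_derive_eq; rewrite !fctE/= -/(s y) /GRing.scale/=.
  by field; rewrite gt_eqF.
rewrite -subr_ge0.
pose f : R -> R := (fun y => 1 - Phi y) - phi * (fun y => (s y)^-1).
apply: (@ge0_of_derive_le0_cvg0 R f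
  (fun y => - phi y - (phi y * (- (s y) ^- 2 * (y / s y))
                       + (s y)^-1 * - (y * phi y)))
  (fun y => - y^-1) x _ _ _ _ x) => //.
- move=> y; apply: is_deriveB; first exact: is_derive_tail.
  apply: is_deriveM; first exact: is_derive_phi.
  apply: (@is_deriveV _ s); first by rewrite gt_eqF.
- move=> y _.
  have sy := s_gt0 y.
  have -> : - phi y - (phi y * (- (s y) ^- 2 * (y / s y))
                       + (s y)^-1 * - (y * phi y)) =
     phi y * (y * (s y ^+ 2 + 1) - s y ^+ 3) / s y ^+ 3.
    by field; rewrite gt_eqF.
  rewrite pmulr_lle0 ?invr_gt0 ?exprn_gt0//.
  rewrite pmulr_rle0 ?phi_gt0// subr_le0.
  have [y0|y0] := leP y 0.
    by apply: (@le_trans _ _ 0); [nra | rewrite exprn_ge0 ?ltW].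
  rewrite -(@ler_pXn2r _ 2) ?nnegrE//; first last.
  + by rewrite exprn_ge0 ?ltW.
  + by nra.
  rewrite exprMn -exprM mulnC exprM s2.
  have := sqr_ge0 y; nra.
- move=> y y0; rewrite /f !fctE.
  have P1 : Phi y <= 1.
    by rewrite -lee_fin fineK ?fin_num_measure// cdf_le1.
  have s1 : (s y)^-1 <= 1.
    by rewrite invf_le1//; have := s2 y; have := s_gt0 y; nra.
  have := phi_le_inv R y y0; have := phi_gt0 R y.
  have : 0 < (s y)^-1 by rewrite invr_gt0.
  nra.
- rewrite -oppr0; apply: cvgN; apply/gtr0_cvgV0; last exact: cvg_id.
  by apply: nbhs_pinfty_gt; rewrite num_real.
Qed.

(** * Numerical estimates *)

(** From [15 / 16 <= exp (- 1 / 16)], raised to the power 32: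
    [(16 / 15) ^+ 32] is about 7.89. *)
Lemma expR2_lt8 (R : realType) : expR 2 < 8 :> R.
Proof.
have h : (15 / 16 : R) <= expR (- 16^-1).
  by apply: le_trans (expR_ge1Dx _); lra.
have -> : (2 : R) = - (- 16^-1 * 32%:R) by field.
rewrite expRN expRM_natr.
have : (15 / 16 : R) ^+ 32 <= expR (- 16^-1) ^+ 32.
  by rewrite lerXn2r ?nnegrE ?expR_ge0//; lra.
move=> h2; rewrite invf_plt ?posrE ?exprn_gt0 ?expR_gt0//.
apply: lt_le_trans h2; lra.
Qed.

Lemma half_lt_ln (R : realType) (n : nat) : (2 <= n)%N -> 1 / 2 < ln (n%:R : R).
Proof.
move=> n2.
have n_ge2 : 2 <= n%:R :> R by rewrite ler_nat.
rewrite -ltr_expR lnK ?posrE; last by lra.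
apply: lt_le_trans n_ge2.
rewrite -(@ltr_pXn2r _ 4) ?nnegrE ?expR_ge0// -expRM_natr.
have -> : 1 / 2 * 4 = 2 :> R by field.
by apply: lt_trans (expR2_lt8 R) _; lra.
Qed.

(** * Bounds on the quantile *)

Lemma b_sqr_lt (R : realType) (n : nat) : (2 <= n)%N ->
  (b_ n : R) ^+ 2 < 2 * ln (n%:R : R).
Proof.
move=> n2; set b : R := b_ n; set L := ln _.
have n_ge2 : 2 <= n%:R :> R by rewrite ler_nat.
have n_gt0 : 0 < n%:R :> R by lra.
have nV2 : n%:R^-1 <= 2^-1 :> R by rewrite lef_pV2 ?posrE.
have nV0 : 0 < n%:R^-1 :> R by rewrite invr_gt0.
have L12 := half_lt_ln R n n2 : 1 / 2 < L.
have [b1|b1] := leP (b ^+ 2) 1; first by lra.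
have Pb : Phi b = 1 - n%:R^-1 by exact: Phi_b.
have tail : n%:R^-1 <= 1 - Phi `|b|.
  have [b0|b0] := leP 0 b.
    by rewrite ger0_norm// Pb; lra.
  by rewrite ltr0_norm// PhiN Pb; lra.
have nb1 : 1 <= `|b| by rewrite -(@ler_pXn2r _ 2) ?nnegrE// expr1n real_normK ?num_real// ltW.
have := le_lt_trans (le_trans tail (Phi_tail_le _ _ nb1)) (phi_lt_expR _ _).
rewrite real_normK ?num_real// -[X in X^-1](@lnK _ n%:R) ?posrE// -expRN ltr_expR.
rewrite -/L; lra.
Qed.

Lemma b_sqr_gt (R : realType) (n : nat) : (2 <= n)%N ->
  2 * ln (n%:R : R) - ln (4 * pi * ln (n%:R : R)) < b_ n ^+ 2.
Proof.
move=> n2; set b : R := b_ n; set L := ln n%:R; set c := ln _.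
have pi2 := @pi_ge2 R.
have e8 := expR2_lt8 R.
have [n3|] := ltnP 2 n; last first.
  move=> n2'; have n2E : n = 2%N by apply/eqP; rewrite eqn_leq n2' n2.
  apply: (@lt_le_trans _ _ 0); last exact: sqr_ge0.
  have L12 := half_lt_ln R n n2 : 1 / 2 < L.
  (* [4 < 4 * pi * ln 2], from [2 <= pi] and [1 / 2 < ln 2]. *)
  have -> : 2 * L = ln 4 by rewrite /L n2E mulr_natl -lnXn// -natrX.
  rewrite subr_lt0 ltr_ln ?posrE//; nra.
have n_ge3 : 3 <= n%:R :> R by rewrite ler_nat.
have n_gt0 : 0 < n%:R :> R by lra.
(* [exp 1 <= 3], since [exp 2 < 8 <= 9]. *)
have L1 : 1 <= L.
  rewrite -ler_expR lnK ?posrE//; apply: le_trans n_ge3.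
  rewrite -(@ler_pXn2r _ 2) ?nnegrE ?expR_ge0// -expRM_natr mul1r.
  by lra.
(* [exp 2 < 8 <= 4 * pi * L]. *)
have c2 : 2 < c.
  rewrite -ltr_expR lnK ?posrE; nra.
have [//|bc] := ltP (2 * L - c) (b ^+ 2).
have := Phi_tail_ge R b; rewrite Phi_b// subKr.
have r2 : 0 < b ^+ 2 + 2 by nra.
have r_gt0 : 0 < Num.sqrt (b ^+ 2 + 2) by rewrite sqrtr_gt0.
rewrite ler_pdivrMr// => tail.
have tail2 : phi b ^+ 2 <= (b ^+ 2 + 2) / n%:R ^+ 2.
  rewrite -[in leRHS](sqr_sqrtr (ltW r2)) -expr_div_n mulrC.
  by rewrite lerXn2r ?nnegrE ?(ltW (phi_gt0 _ _))// mulr_ge0 ?invr_ge0 ?ltW.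
have phi2 : 2 * L / n%:R ^+ 2 <= phi b ^+ 2.
  have -> : 2 * L / n%:R ^+ 2 = (2 * pi)^-1 * expR (c - 2 * L).
    rewrite expRB lnK ?posrE; last by nra.
    rewrite [2 * L]mulrC expRM_natr lnK ?posrE//; field.
    by apply/andP; split; lra.
  rewrite phiE exprMn exprVn sqr_sqrtr; last by lra.
  rewrite -expRM_natr ler_pM2l ?invr_gt0; last by lra.
  by rewrite ler_expR; lra.
have := le_trans phi2 tail2.
rewrite ler_pM2r ?invr_gt0 ?exprn_gt0//; lra.
Qed.

Theorem proposition4 (R : realType) (n : nat) (hn : (2 <= n)%N) :
  2 * ln (n%:R : R) - ln (4 * pi * ln (n%:R : R)) < b_ n ^+ 2
  < 2 * ln (n%:R : R).
Proof. by rewrite b_sqr_gt// b_sqr_lt. Qed.
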